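(* Let $p\colon \mathbb{E}\to\mathbb{B}$ be a locally small bifibration. Let $m$ be a vertical map over $p$. Then there is an lawfs $(L_1,R_1)$ such that $R_1$-algebra structures on a vertical map $f$ correspond precisely to solutions of the universal lifting problem from $m$ to $f$, and $m$ can be given the structure of an $L_1$-coalgebra.
   Context: Fibrations. $p\colon\mathbb{E}\to\mathbb{B}$ is a cloven Grothendieck fibration, with reindexing $\sigma^*$ and chosen cartesian maps $\overline\sigma\colon\sigma^*Y\to Y$ (all categorical structure is understood as chosen). It is a bifibration if moreover $p^{op}\colon\mathbb{E}^{op}\to\mathbb{B}^{op}$ is a fibration (opcartesian lifts exist). A map of $\mathbb{E}$ is vertical over $I$ if $p$ sends it to $1_I$; $\mathbb{E}_I$ is the fibre category. $V(\mathbb{E})$ is the full subcategory of the arrow category $\mathbb{E}^{\mathbf 2}$ on vertical maps; $p\circ\mathrm{dom}=p\circ\mathrm{cod}\colon V(\mathbb{E})\to\mathbb{B}$ is a fibration with levelwise reindexing. $p$ is locally small if for all $I$ and $X,Y\in\mathbb{E}_I$ the functor $(\mathbb{B}/I)^{op}\to\mathbf{Set}$, $(u\colon J\to I)\mapsto \mathbb{E}_J(u^*X,u^*Y)$, is representable. Lifting problems. Let $m\colon U\to V$ be vertical over $I$ and $f\colon X\to Y$ vertical over $J$. A family of lifting problems from $m$ to $f$ over $K$ consists of $\sigma\colon K\to I$, $\tau\colon K\to J$ and a morphism $h\colon\sigma^*(m)\to f$ of $V(\mathbb{E})$ over $\tau$, i.e. a commutative square with left side $\sigma^*(m)$, right side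 $f$ and horizontal maps over $\tau$. A solution is a map $j\colon\sigma^*(V)\to X$ making both triangles commute. The universal lifting problem from $m$ to $f$ (defined under the assumption, in force here, that $\mathbb{B}$ has finite limits and $p$ is locally small) is a family $(\underline{\mathrm{Hom}}(m,f),\sigma,\tau,h)$ such that for every family $(K',\sigma',\tau',h')$ there is a unique $t\colon K'\to\underline{\mathrm{Hom}}(m,f)$ with $\sigma t=\sigma'$, $\tau t=\tau'$ and $h'=h\circ c$, where $c\colon\sigma'^*(m)\to\sigma^*(m)$ is the canonical cartesian map over $t$. Lawfs. A functorial factorisation over $\mathbb{B}$ functorially factors each vertical $f\colon X\to Y$ as $X\xrightarrow{Lf}Kf\xrightarrow{Rf}Y$ with both maps vertical (functorially in morphisms of $V(\mathbb{E})$, over $\mathbb{B}$). Then $R$ is a pointed endofunctor over $\mathrm{cod}\colon V(\mathbb{E})\to\mathbb{E}$, with unit $f\to Rf$ given by $(Lf,1_Y)$, and $L$ is a copointed endofunctor over $\mathrm{dom}\colon V(\mathbb{E})\to\mathbb{E}$, with counit $Lf\to f$ given by $(1_X,Rf)$. An lawfs (left half of an algebraic weak factorisation system) over $\mathbb{B}$ is a comonad over $\mathrm{dom}\colon V(\mathbb{E})\to\mathbb{E}$ (i.e. commuting with $\mathrm{dom}$ and with counit and comultiplication having identity domain components); equivalently, a functorial factorisation with a comultiplication $\Sigma\colon L\Rightarrow L^2$ making $L$ a comonad over $\mathrm{dom}$. An $R$-algebra structure on $f$ is a map $\alpha\colon Rf\to f$ in $V(\mathbb{E})$ satisfying the unit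 law $\alpha\circ(Lf,1_Y)=1_f$ (algebra for the pointed endofunctor). An $L$-coalgebra is a coalgebra for the comonad.
   Formalization: The formal theorem adds the hypothesis that every fibre category has (chosen) pushouts; without any pushout hypothesis the statement about locally small bifibrations is false, e.g. for set-indexed families in a suitable free coproduct completion. *)

(* Defs.v *)
From Stdlib Require Import ProofIrrelevance.

Set Implicit Arguments.
Unset Strict Implicit.

(** * Categories *)

Record Category := {
  Ob :> Type;
  Hom : Ob -> Ob -> Type;
  idm : forall x, Hom x x;
  comp : forall x y z, Hom y z -> Hom x y -> Hom x z;
  comp_id_l : forall x y (f : Hom x y), comp (idm y) f = f;
  comp_id_r : forall x y (f : Hom x y), comp f (idm x) = f;
  comp_assoc : forall x y z w (h : Hom z w) (g : Hom y z) (f : Hom x y),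
    comp h (comp g f) = comp (comp h g) f
}.

Arguments Hom {_} _ _.
Arguments idm {_} _.
Arguments comp {_ x y z} _ _.

Declare Scope cat_scope.
Delimit Scope cat_scope with cat.
Notation "x ~> y" := (Hom x y) (at level 90, no associativity) : cat_scope.
Notation "g ∘ f" := (comp g f) (at level 40, left associativity) : cat_scope.
Local Open Scope cat_scope.

Record Functor (C D : Category) := {
  fob :> C -> D;
  fmap : forall x y : C, (x ~> y) -> (fob x ~> fob y);
  fmap_id : forall x : C, fmap (idm x) = idm (fob x);
  fmap_comp : forall (x y z : C) (g : y ~> z) (f : x ~> y),
    fmap (g ∘ f) = fmap g ∘ fmap f
}.

Arguments fmap {C D} _ {x y} _.

Definition op (C : Category) : Category := {|
  Ob := C;
  Hom := fun x y => @Hom C y x;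
  idm := @idm C;
  comp := fun x y z g f => @comp C z y x f g;
  comp_id_l := fun x y f => comp_id_r f;
  comp_id_r := fun x y f => comp_id_l f;
  comp_assoc := fun x y z w h g f => eq_sym (comp_assoc f g h)
|}.

Definition op_functor (C D : Category) (F : Functor C D) :
    Functor (op C) (op D) :=
  @Build_Functor (op C) (op D) (fun x => F x)
    (fun x y f => @fmap C D F y x f)
    (fun x => fmap_id F x)
    (fun x y z g f => @fmap_comp C D F z y x f g).

Record slice_ob (B : Category) (I : B) := {
  sl_dom : B;
  sl_arr : sl_dom ~> I
}.

Record slice_hom (B : Category) (I : B) (u v : slice_ob I) := {
  sl_map : sl_dom u ~> sl_dom v;
  sl_tri : sl_arr v ∘ sl_map = sl_arr u
}.

Lemma slice_hom_ext (B : Category) (I : B) (u v : slice_ob I)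
  (a b : slice_hom u v) : sl_map a = sl_map b -> a = b.
Proof.
  destruct a as [a Ha], b as [b Hb]; simpl; intros <-.
  now rewrite (proof_irrelevance _ Ha Hb).
Qed.

Definition slice (B : Category) (I : B) : Category.
Proof.
  refine {| Ob := slice_ob I;
            Hom := @slice_hom B I;
            idm := fun u => @Build_slice_hom B I u u (idm _) (comp_id_r _);
            comp := fun u v w b a =>
              @Build_slice_hom B I u w (sl_map b ∘ sl_map a) _ |}.
  - intros; apply slice_hom_ext; apply comp_id_l.
  - intros; apply slice_hom_ext; apply comp_id_r.
  - intros; apply slice_hom_ext; apply comp_assoc.
  Unshelve.
  rewrite comp_assoc, sl_tri; apply sl_tri.
Defined.

Record terminal_object (C : Category) := {
  term_ob : C;
  term_arr : forall x : C, x ~> term_ob;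
  term_uniq : forall (x : C) (f g : x ~> term_ob), f = g
}.

Record pullback (C : Category) (x y z : C) (f : x ~> z) (g : y ~> z) := {
  pb_ob : C;
  pb_fst : pb_ob ~> x;
  pb_snd : pb_ob ~> y;
  pb_comm : f ∘ pb_fst = g ∘ pb_snd;
  pb_univ : forall (w : C) (a : w ~> x) (b : w ~> y), f ∘ a = g ∘ b ->
    exists! h : w ~> pb_ob, pb_fst ∘ h = a /\ pb_snd ∘ h = b
}.

Definition pullbacks (C : Category) : Type :=
  forall (x y z : C) (f : x ~> z) (g : y ~> z), pullback f g.

Definition pushouts (C : Category) : Type := pullbacks (op C).

Definition finite_limits (C : Category) : Type :=
  (terminal_object C * pullbacks C)%type.

Definition bijective (X Y : Type) (f : X -> Y) : Prop :=
  (forall x x', f x = f x' -> x = x') /\ (forall y, exists x, f x = y).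

(** * Comonads, coalgebras, algebras for pointed endofunctors *)

Record is_comonad (C : Category) (T : Functor C C)
    (eps : forall x : C, T x ~> x) (delta : forall x : C, T x ~> T (T x)) :
    Prop := {
  counit_nat : forall (x y : C) (s : x ~> y), eps y ∘ fmap T s = s ∘ eps x;
  comult_nat : forall (x y : C) (s : x ~> y),
    delta y ∘ fmap T s = fmap T (fmap T s) ∘ delta x;
  counit_l : forall x : C, eps (T x) ∘ delta x = idm (T x);
  counit_r : forall x : C, fmap T (eps x) ∘ delta x = idm (T x);
  coassoc : forall x : C,
    delta (T x) ∘ delta x = fmap T (delta x) ∘ delta x
}.

Record coalgebra (C : Category) (T : Functor C C)
    (eps : forall x : C, T x ~> x) (delta : forall x : C, T x ~> T (T x))
    (x : C) := {
  coalg_map : x ~> T x;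
  coalg_counit : eps x ∘ coalg_map = idm x;
  coalg_comult : delta x ∘ coalg_map = fmap T coalg_map ∘ coalg_map
}.

Record pointed_algebra (C : Category) (T : Functor C C)
    (eta : forall x : C, x ~> T x) (x : C) := {
  alg_map : T x ~> x;
  alg_unit : alg_map ∘ eta x = idm x
}.

Definition pointed_algebra_hom (C : Category) (T : Functor C C)
    (eta : forall x : C, x ~> T x) (x y : C)
    (a : pointed_algebra eta x) (b : pointed_algebra eta y) (s : x ~> y) :
    Prop :=
  s ∘ alg_map a = alg_map b ∘ fmap T s.

(** * Fibrations *)

Section Fibrations.

Variables (B E : Category) (p : Functor E B).

Record fibre_ob (I : B) := {
  fib_ob :> E;
  fib_over : p fib_ob = I
}.

(** The image under [p] of a map between objects lying over [I] and [J], as a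
    map [I ~> J]: the only place where equalities of objects of the base are
    transported along. *)
Definition pmap (I J : B) (X : fibre_ob I) (Y : fibre_ob J) (f : X ~> Y) :
    I ~> J :=
  match fib_over X in _ = I' return I' ~> J with
  | eq_refl =>
      match fib_over Y in _ = J' return p X ~> J' with
      | eq_refl => fmap p f
      end
  end.

Lemma pmap_id (I : B) (X : fibre_ob I) : @pmap I I X X (idm X) = idm I.
Proof. destruct X as [X []]; apply fmap_id. Qed.

Lemma pmap_comp (I J K : B) (X : fibre_ob I) (Y : fibre_ob J)
  (Z : fibre_ob K) (g : Y ~> Z) (f : X ~> Y) :
  @pmap I K X Z (g ∘ f) = @pmap J K Y Z g ∘ @pmap I J X Y f.
Proof.
  destruct X as [X []], Y as [Y []], Z as [Z []]; apply fmap_comp.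
Qed.

Record fibre_hom (I : B) (X Y : fibre_ob I) := {
  fib_map :> X ~> Y;
  fib_vert : @pmap I I X Y fib_map = idm I
}.

Lemma fibre_hom_ext (I : B) (X Y : fibre_ob I) (f g : fibre_hom X Y) :
  fib_map f = fib_map g -> f = g.
Proof.
  destruct f as [f Hf], g as [g Hg]; simpl; intros <-.
  now rewrite (proof_irrelevance _ Hf Hg).
Qed.

Definition fibre (I : B) : Category.
Proof.
  refine {| Ob := fibre_ob I;
            Hom := @fibre_hom I;
            idm := fun X => @Build_fibre_hom I X X (idm _) (pmap_id X);
            comp := fun X Y Z g f =>
              @Build_fibre_hom I X Z (fib_map g ∘ fib_map f) _ |}.
  - intros; apply fibre_hom_ext; apply comp_id_l.
  - intros; apply fibre_hom_ext; apply comp_id_r.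
  - intros; apply fibre_hom_ext; apply comp_assoc.
  Unshelve.
  rewrite (pmap_comp (Y := Y)), !fib_vert; apply comp_id_l.
Defined.

(** The factorisation is unique, so carrying it as data is a choice of
    witnesses only. *)
Record cartesian (J I : B) (X : fibre_ob J) (Y : fibre_ob I) (f : X ~> Y) := {
  cart_fac : forall (K : B) (Z : fibre_ob K) (g : Z ~> Y) (w : K ~> J),
    @pmap J I X Y f ∘ w = @pmap K I Z Y g -> Z ~> X;
  cart_fac_over : forall K (Z : fibre_ob K) g w e,
    @pmap K J Z X (@cart_fac K Z g w e) = w;
  cart_fac_comm : forall K (Z : fibre_ob K) g w e,
    f ∘ @cart_fac K Z g w e = g;
  cart_fac_uniq : forall K (Z : fibre_ob K) g w e (k : Z ~> X),
    @pmap K J Z X k = w -> f ∘ k = g -> k = @cart_fac K Z g w e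
}.

Record cloven_fibration := {
  reindex : forall (J I : B), (J ~> I) -> fibre_ob I -> fibre_ob J;
  lift : forall (J I : B) (u : J ~> I) (Y : fibre_ob I), reindex u Y ~> Y;
  lift_over : forall (J I : B) (u : J ~> I) (Y : fibre_ob I),
    @pmap J I (reindex u Y) Y (lift u Y) = u;
  lift_cart : forall (J I : B) (u : J ~> I) (Y : fibre_ob I),
    @cartesian J I (reindex u Y) Y (lift u Y)
}.

(** * The category of vertical maps *)

Record vmap := {
  vbase : B;
  vdom : fibre_ob vbase;
  vcod : fibre_ob vbase;
  varr : fibre_hom vdom vcod
}.

Record vsq (f g : vmap) := {
  sq_dom : vdom f ~> vdom g;
  sq_cod : vcod f ~> vcod g;
  sq_comm : sq_cod ∘ varr f = varr g ∘ sq_dom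
}.

Lemma vsq_ext (f g : vmap) (s t : vsq f g) :
  sq_dom s = sq_dom t -> sq_cod s = sq_cod t -> s = t.
Proof.
  destruct s as [a b Hs], t as [a' b' Ht]; simpl; intros <- <-.
  now rewrite (proof_irrelevance _ Hs Ht).
Qed.

Definition vert : Category.
Proof.
  unshelve refine {| Ob := vmap;
            Hom := vsq;
            idm := fun f => @Build_vsq f f (idm _) (idm _) _;
            comp := fun f g h t s =>
              @Build_vsq f h (sq_dom t ∘ sq_dom s) (sq_cod t ∘ sq_cod s) _ |}.
  - now rewrite comp_id_l, comp_id_r.
  - now rewrite <- comp_assoc, sq_comm, comp_assoc, sq_comm, comp_assoc.
  - intros; apply vsq_ext; apply comp_id_l.
  - intros; apply vsq_ext; apply comp_id_r.
  - intros; apply vsq_ext; apply comp_assoc.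
Defined.

(** The base map of a square; its two horizontal sides have the same one. *)
Definition sq_base (f g : vmap) (s : vsq f g) : vbase f ~> vbase g :=
  @pmap _ _ (vdom f) (vdom g) (sq_dom s).

Lemma sq_base_cod (f g : vmap) (s : vsq f g) :
  @pmap _ _ (vcod f) (vcod g) (sq_cod s) = sq_base s.
Proof.
  pose proof (f_equal (@pmap _ _ (vdom f) (vcod g)) (sq_comm s)) as H.
  rewrite (pmap_comp (Y := vcod f)), (pmap_comp (Y := vdom g)), !fib_vert in H.
  now rewrite comp_id_l, comp_id_r in H.
Qed.

(** * Functorial factorisations and lawfs *)

Record functorial_factorisation := {
  ff_mid : forall f : vmap, fibre_ob (vbase f);
  ff_left : forall f : vmap, fibre_hom (vdom f) (ff_mid f);
  ff_right : forall f : vmap, fibre_hom (ff_mid f) (vcod f);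
  ff_fac : forall f : vmap, ff_right f ∘ ff_left f = varr f;
  ff_map : forall f g : vmap, vsq f g -> (ff_mid f ~> ff_mid g);
  ff_map_left : forall (f g : vmap) (s : vsq f g),
    ff_map s ∘ ff_left f = ff_left g ∘ sq_dom s;
  ff_map_right : forall (f g : vmap) (s : vsq f g),
    sq_cod s ∘ ff_right f = ff_right g ∘ ff_map s;
  ff_map_over : forall (f g : vmap) (s : vsq f g),
    @pmap _ _ (ff_mid f) (ff_mid g) (ff_map s) = sq_base s;
  ff_map_id : forall f : vmap, ff_map (@idm vert f) = idm (ff_mid f);
  ff_map_comp : forall (f g h : vmap) (t : vsq g h) (s : vsq f g),
    ff_map (@comp vert f g h t s) = ff_map t ∘ ff_map s
}.

Section Factorisation.

Variable F : functorial_factorisation.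

Definition L_ob (f : vmap) : vmap := Build_vmap (ff_left F f).
Definition R_ob (f : vmap) : vmap := Build_vmap (ff_right F f).

Definition L_map (f g : vmap) (s : vsq f g) : vsq (L_ob f) (L_ob g) :=
  @Build_vsq (L_ob f) (L_ob g) (sq_dom s) (ff_map F s) (ff_map_left F s).

Definition R_map (f g : vmap) (s : vsq f g) : vsq (R_ob f) (R_ob g) :=
  @Build_vsq (R_ob f) (R_ob g) (ff_map F s) (sq_cod s) (ff_map_right F s).

Definition L_functor : Functor vert vert.
Proof.
  refine (@Build_Functor vert vert L_ob L_map _ _).
  - intros f; apply vsq_ext; [reflexivity | exact (ff_map_id F f)].
  - intros f g h t s; apply vsq_ext; [reflexivity | exact (ff_map_comp F t s)].
Defined.

Definition R_functor : Functor vert vert.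
Proof.
  refine (@Build_Functor vert vert R_ob R_map _ _).
  - intros f; apply vsq_ext; [exact (ff_map_id F f) | reflexivity].
  - intros f g h t s; apply vsq_ext; [exact (ff_map_comp F t s) | reflexivity].
Defined.

Definition L_counit (f : vert) : L_functor f ~> f.
Proof.
  refine (@Build_vsq (L_ob f) f (idm (fib_ob (vdom f))) (ff_right F f) _).
  exact (eq_trans (ff_fac F f) (eq_sym (comp_id_r _))).
Defined.

Definition R_unit (f : vert) : f ~> R_functor f.
Proof.
  refine (@Build_vsq f (R_ob f) (ff_left F f) (idm (fib_ob (vcod f))) _).
  exact (eq_trans (comp_id_l _) (eq_sym (ff_fac F f))).
Defined.

End Factorisation.

Record lawfs := {
  lawfs_ff : functorial_factorisation;
  lawfs_comult : forall f : vert,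
    L_functor lawfs_ff f ~> L_functor lawfs_ff (L_functor lawfs_ff f);
  lawfs_comult_dom : forall f : vmap,
    sq_dom (lawfs_comult f) = idm (vdom f);
  lawfs_comonad :
    @is_comonad vert (L_functor lawfs_ff) (L_counit lawfs_ff) lawfs_comult
}.

Definition L_coalgebra (W : lawfs) (f : vmap) : Type :=
  @coalgebra vert (L_functor (lawfs_ff W)) (L_counit (lawfs_ff W))
    (@lawfs_comult W) f.

Definition R_algebra (W : lawfs) (f : vmap) : Type :=
  @pointed_algebra vert (R_functor (lawfs_ff W)) (R_unit (lawfs_ff W)) f.

Definition R_algebra_hom (W : lawfs) (f g : vmap) (s : vsq f g)
    (a : R_algebra W f) (b : R_algebra W g) : Prop :=
  pointed_algebra_hom a b s.

(** * Reindexing, local smallness *)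

Variable cl : cloven_fibration.

Definition canon (K' K I : B) (u' : K' ~> I) (u : K ~> I) (t : K' ~> K)
    (e : u ∘ t = u') (X : fibre_ob I) : reindex cl u' X ~> reindex cl u X.
Proof.
  refine (cart_fac (lift_cart cl u X) (Z := reindex cl u' X)
            (g := lift cl u' X) (w := t) _).
  now rewrite !lift_over.
Defined.

Lemma canon_over (K' K I : B) (u' : K' ~> I) (u : K ~> I) (t : K' ~> K)
  (e : u ∘ t = u') (X : fibre_ob I) :
  @pmap K' K (reindex cl u' X) (reindex cl u X) (canon e X) = t.
Proof. apply cart_fac_over. Qed.

Lemma lift_canon (K' K I : B) (u' : K' ~> I) (u : K ~> I) (t : K' ~> K)
  (e : u ∘ t = u') (X : fibre_ob I) :
  lift cl u X ∘ canon e X = lift cl u' X.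
Proof. apply cart_fac_comm. Qed.

Lemma lift_inj (K J I : B) (u : J ~> I) (Y : fibre_ob I) (Z : fibre_ob K)
  (a b : Z ~> reindex cl u Y) :
  @pmap K J Z (reindex cl u Y) a = @pmap K J Z (reindex cl u Y) b ->
  lift cl u Y ∘ a = lift cl u Y ∘ b -> a = b.
Proof.
  intros Hw Hc.
  assert (e : @pmap J I (reindex cl u Y) Y (lift cl u Y) ∘
              @pmap K J Z (reindex cl u Y) b =
              @pmap K I Z Y (lift cl u Y ∘ b))
    by now rewrite (pmap_comp (Y := reindex cl u Y)).
  rewrite (cart_fac_uniq (lift_cart cl u Y) (Z := Z) e Hw Hc).
  symmetry; now apply cart_fac_uniq.
Qed.

Definition reindex_hom (J I : B) (u : J ~> I) (X Y : fibre_ob I)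
    (f : fibre_hom X Y) : fibre_hom (reindex cl u X) (reindex cl u Y).
Proof.
  unshelve refine (@Build_fibre_hom J (reindex cl u X) (reindex cl u Y)
    (cart_fac (lift_cart cl u Y) (Z := reindex cl u X)
       (g := f ∘ lift cl u X) (w := idm J) _) _).
  - now rewrite (pmap_comp (Y := X)), fib_vert, !lift_over, comp_id_l, comp_id_r.
  - apply cart_fac_over.
Defined.

Lemma lift_reindex_hom (J I : B) (u : J ~> I) (X Y : fibre_ob I)
  (f : fibre_hom X Y) :
  lift cl u Y ∘ reindex_hom u f = f ∘ lift cl u X.
Proof. apply cart_fac_comm. Qed.

(** The action of [w : u' ~> u] on the presheaf [u |-> E_J(u^*X, u^*Y)]: the
    reindexing [w^*g], read as a map [u'^*X ~> u'^*Y] along the canonical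
    isomorphisms, is the unique vertical [k] with
    [lift u' Y ∘ k = lift u Y ∘ g ∘ canon]. *)
Definition hom_restrict (I : B) (X Y : fibre_ob I) (u u' : slice I)
    (w : u' ~> u)
    (g : fibre_hom (reindex cl (sl_arr u) X) (reindex cl (sl_arr u) Y)) :
    fibre_hom (reindex cl (sl_arr u') X) (reindex cl (sl_arr u') Y).
Proof.
  unshelve refine
    (@Build_fibre_hom _ (reindex cl (sl_arr u') X) (reindex cl (sl_arr u') Y)
      (cart_fac (lift_cart cl (sl_arr u') Y) (Z := reindex cl (sl_arr u') X)
         (g := lift cl (sl_arr u) Y ∘ (g ∘ canon (sl_tri w) X))
         (w := idm _) _) _).
  - rewrite (pmap_comp (Y := reindex cl (sl_arr u) Y)),
      (pmap_comp (Y := reindex cl (sl_arr u) X)).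
    rewrite fib_vert, canon_over, !lift_over, comp_id_l, comp_id_r.
    symmetry; apply sl_tri.
  - apply cart_fac_over.
Defined.

Record hom_representation (I : B) (X Y : fibre_ob I) := {
  rep_ob : slice I;
  rep_iso : forall u : slice I, (u ~> rep_ob) ->
    fibre_hom (reindex cl (sl_arr u) X) (reindex cl (sl_arr u) Y);
  rep_bij : forall u : slice I, bijective (@rep_iso u);
  rep_nat : forall (u u' : slice I) (w : u' ~> u) (k : u ~> rep_ob),
    rep_iso (k ∘ w) = hom_restrict w (rep_iso k)
}.

Definition locally_small : Type :=
  forall (I : B) (X Y : fibre_ob I), hom_representation X Y.

(** * Lifting problems *)

Definition reindex_vmap (m : vmap) (K : B) (u : K ~> vbase m) : vmap :=
  Build_vmap (reindex_hom u (varr m)).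

Definition canon_sq (m : vmap) (K' K : B) (u' : K' ~> vbase m)
    (u : K ~> vbase m) (t : K' ~> K) (e : u ∘ t = u') :
    vsq (reindex_vmap u') (reindex_vmap u).
Proof.
  refine (@Build_vsq (reindex_vmap u') (reindex_vmap u)
            (canon e (vdom m)) (canon e (vcod m)) _).
  simpl.
  apply (lift_inj (Z := reindex cl u' (vdom m))).
  - rewrite (pmap_comp (Y := reindex cl u' (vcod m))),
      (pmap_comp (Y := reindex cl u (vdom m))).
    now rewrite !canon_over, !cart_fac_over, comp_id_l, comp_id_r.
  - rewrite !comp_assoc, lift_canon.
    change (lift cl u' (vcod m) ∘ reindex_hom u' (varr m) =
      lift cl u (vcod m) ∘ reindex_hom u (varr m) ∘ canon e (vdom m)).
    now rewrite !lift_reindex_hom, <- comp_assoc, lift_canon.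
Defined.

Record lifting_family (m f : vmap) := {
  lf_index : B;
  lf_src : lf_index ~> vbase m;
  lf_tgt : lf_index ~> vbase f;
  lf_sq : vsq (reindex_vmap lf_src) f;
  lf_over : sq_base lf_sq = lf_tgt
}.

Definition factors_through (m f : vmap) (P' P : lifting_family m f)
    (t : lf_index P' ~> lf_index P) : Prop :=
  lf_tgt P ∘ t = lf_tgt P' /\
  exists e : lf_src P ∘ t = lf_src P',
    lf_sq P' = @comp vert _ _ _ (lf_sq P) (canon_sq e).

Arguments factors_through {m f} P' P t.

Definition is_universal (m f : vmap) (P : lifting_family m f) : Prop :=
  forall P' : lifting_family m f, exists! t, factors_through P' P t.

Record universal_lifting_problem (m f : vmap) := {
  ulp_family :> lifting_family m f;
  ulp_universal : is_universal ulp_family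
}.

Record solution (m f : vmap) (P : lifting_family m f) := {
  sol_map : reindex cl (lf_src P) (vcod m) ~> vdom f;
  sol_upper : sol_map ∘ reindex_hom (lf_src P) (varr m) = sq_dom (lf_sq P);
  sol_lower : varr f ∘ sol_map = sq_cod (lf_sq P)
}.

Definition post_family (m f g : vmap) (s : vsq f g) (P : lifting_family m f) :
    lifting_family m g.
Proof.
  refine (@Build_lifting_family m g (lf_index P) (lf_src P)
            (sq_base s ∘ lf_tgt P) (@comp vert _ _ _ s (lf_sq P)) _).
  rewrite <- (lf_over P).
  exact (pmap_comp (Y := vdom f) (Z := vdom g) (sq_dom s) (sq_dom (lf_sq P))).
Defined.

(** A square [s : f ~> g] turns a family of problems from [m] to [f] into one
    from [m] to [g]; [s] preserves the solutions [j], [k] when the solution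
    induced by [j] is the reindexing of [k] along the comparison of indices. *)
Definition solution_hom (m f g : vmap) (s : vsq f g)
    (P : lifting_family m f) (Q : lifting_family m g)
    (j : solution P) (k : solution Q) : Prop :=
  exists (t : lf_index P ~> lf_index Q) (e : lf_src Q ∘ t = lf_src P),
    factors_through (post_family s P) Q t /\
    sq_dom s ∘ sol_map j = sol_map k ∘ canon e (vcod m).

End Fibrations.

Definition cloven_opfibration (B E : Category) (p : Functor E B) : Type :=
  cloven_fibration (op_functor p).

(* Main.v *)
(** Write the universal lifting problem of [f] as a square [h] from [σ^*m] to [f],
    and define [K f] as the pushout in the total category of [σ^*m] along the
    domain side of [h].  Then a map out of [K f] is a map out of [dom f] together
    with compatible diagonals for all lifting problems from [m] to [f], natural
    in the indexing object.  Taking this as the universal property of [K f],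
    retractions of [L f] over [cod f] are the solutions of [h], the
    comultiplication sends the diagonal of a problem [q] to that of the problem
    from [m] to [L f] whose lower side is the diagonal of [q], and the coalgebra
    structure on [m] is the diagonal of the identity problem from [m] to [m]. *)

From Stdlib Require Import IndefiniteDescription ProofIrrelevance.
Require Import Defs.
Set Implicit Arguments.
Unset Strict Implicit.
Local Open Scope cat_scope.

(** Universal properties are propositions here; choice turns their witnesses into data from which
    factorisations can be built. *)
Definition the_unique (A : Type) (P : A -> Prop) (h : exists! x, P x) :
    {x | P x} :=
  constructive_indefinite_description P
    (ex_intro P (proj1_sig (constructive_indefinite_description _ h))
       (proj1 (proj2_sig (constructive_indefinite_description _ h)))).

Lemma comp_eq_r (C : Category) (x y z w : C) (g : y ~> z) (f : x ~> y)
  (h : x ~> z) (H : g ∘ f = h) (k : w ~> x) : g ∘ (f ∘ k) = h ∘ k.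
Proof. now rewrite comp_assoc, H. Qed.


Ltac reassoc := repeat rewrite <- comp_assoc.

Ltac simpl_sq :=
  cbn [vbase vdom vcod varr sq_dom sq_cod comp vert canon_sq reindex_vmap].

(** * Opcartesian lifts and factorisation through chosen cartesian lifts *)

Section Fibred.

Variables (B E : Category) (p : Functor E B).

Lemma pmap_vert_l (I J : B) (X : fibre_ob p I) (Y Z : fibre_ob p J)
  (g : fibre_hom Y Z) (f : X ~> Y) :
  @pmap _ _ p _ _ X Z (g ∘ f) = @pmap _ _ p _ _ X Y f.
Proof. now rewrite (pmap_comp (Y := Y)), fib_vert, comp_id_l. Qed.

Lemma pmap_vert_r (I J : B) (X Y : fibre_ob p I) (Z : fibre_ob p J)
  (g : Y ~> Z) (f : fibre_hom X Y) :
  @pmap _ _ p _ _ X Z (g ∘ f) = @pmap _ _ p _ _ Y Z g.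
Proof. now rewrite (pmap_comp (Y := Y)), fib_vert, comp_id_r. Qed.

Definition opcartesian (I J : B) (X : fibre_ob p I) (Y : fibre_ob p J)
    (f : X ~> Y) : Prop :=
  forall (K : B) (Z : fibre_ob p K) (g : X ~> Z) (w : J ~> K),
    w ∘ @pmap _ _ p _ _ X Y f = @pmap _ _ p _ _ X Z g ->
    exists! k : Y ~> Z, @pmap _ _ p _ _ Y Z k = w /\ k ∘ f = g.

Definition op_fibre_ob (I : B) (X : fibre_ob p I) : fibre_ob (op_functor p) I :=
  @Build_fibre_ob (op B) (op E) (op_functor p) I (fib_ob X) (fib_over X).

Definition unop_fibre_ob (I : B) (X : fibre_ob (op_functor p) I) :
    fibre_ob p I :=
  @Build_fibre_ob B E p I (fib_ob X) (fib_over X).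

(** The two sides match on the same equalities of base objects in opposite orders, so they become
    convertible once these are destructed. *)
Lemma pmap_op (I J : B) (X : fibre_ob p I) (Y : fibre_ob p J) (f : X ~> Y) :
  @pmap _ _ (op_functor p) J I (op_fibre_ob Y) (op_fibre_ob X) f =
  @pmap _ _ p I J X Y f.
Proof. destruct X as [X []], Y as [Y []]; reflexivity. Qed.

Lemma pmap_unop (I J : B) (X : fibre_ob p I)
  (Y : fibre_ob (op_functor p) J) (f : @Hom (op E) Y (op_fibre_ob X)) :
  @pmap _ _ (op_functor p) J I Y (op_fibre_ob X) f =
  @pmap _ _ p I J X (unop_fibre_ob Y) f.
Proof. destruct X as [X []], Y as [Y []]; reflexivity. Qed.

Lemma pmap_unop_r (I J : B) (X : fibre_ob p I)
  (Y : fibre_ob (op_functor p) J) (f : @Hom (op E) (op_fibre_ob X) Y) :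
  @pmap _ _ (op_functor p) I J (op_fibre_ob X) Y f =
  @pmap _ _ p J I (unop_fibre_ob Y) X f.
Proof. destruct X as [X []], Y as [Y []]; reflexivity. Qed.

Lemma opcartesian_lift (opcl : cloven_opfibration p) (I J : B) (u : I ~> J)
  (X : fibre_ob p I) :
  {Y : fibre_ob p J & {f : X ~> Y |
     @pmap _ _ p _ _ X Y f = u /\ opcartesian f}}.
Proof.
  pose (Y := reindex opcl (u : @Hom (op B) J I) (op_fibre_ob X)).
  pose (l := lift opcl (u : @Hom (op B) J I) (op_fibre_ob X)).
  pose proof (lift_over opcl (u : @Hom (op B) J I) (op_fibre_ob X)) as Hl.
  pose proof (lift_cart opcl (u : @Hom (op B) J I) (op_fibre_ob X)) as Hc.
  fold l in Hl, Hc; fold Y in l, Hl, Hc.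
  exists (unop_fibre_ob Y), l.
  rewrite pmap_unop in Hl.
  split; [exact Hl|].
  intros K Z g w e.
  rewrite Hl in e.
  assert (e' : @comp (op B) K J I
       (@pmap _ _ (op_functor p) _ _ Y (op_fibre_ob X) l) w =
     @pmap _ _ (op_functor p) _ _ (op_fibre_ob Z) (op_fibre_ob X) g).
  { rewrite pmap_op, pmap_unop, Hl; exact e. }
  exists (cart_fac Hc (Z := op_fibre_ob Z) e'); split; [split|].
  - rewrite <- (cart_fac_over Hc (Z := op_fibre_ob Z) e').
    symmetry; apply pmap_unop_r.
  - exact (cart_fac_comm Hc (Z := op_fibre_ob Z) e').
  - intros k [H1 H2]; symmetry; apply (cart_fac_uniq Hc (Z := op_fibre_ob Z)).
    + now rewrite pmap_unop_r.
    + exact H2.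
Qed.

Lemma opcartesian_epi (I J K : B) (X : fibre_ob p I) (Y : fibre_ob p J)
  (Z : fibre_ob p K) (f : X ~> Y) (a b : Y ~> Z) :
  opcartesian f ->
  @pmap _ _ p _ _ Y Z a = @pmap _ _ p _ _ Y Z b -> a ∘ f = b ∘ f -> a = b.
Proof.
  intros Hf Hw Hc.
  destruct (Hf K Z (a ∘ f) (@pmap _ _ p _ _ Y Z a)) as [k [_ Hk]].
  { now rewrite (pmap_comp (Y := Y)). }
  rewrite <- (Hk a), <- (Hk b); auto.
Qed.

Variable cl : cloven_fibration p.

Lemma lift_factor (I J K : B) (u : J ~> I) (Y : fibre_ob p I)
  (Z : fibre_ob p K) (g : Z ~> Y) (w : K ~> J)
  (e : u ∘ w = @pmap _ _ p _ _ Z Y g) :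
  {k : Z ~> reindex cl u Y |
    @pmap _ _ p _ _ Z (reindex cl u Y) k = w /\ lift cl u Y ∘ k = g}.
Proof.
  assert (e' : @pmap _ _ p _ _ (reindex cl u Y) Y (lift cl u Y) ∘ w =
               @pmap _ _ p _ _ Z Y g) by now rewrite lift_over.
  exists (cart_fac (lift_cart cl u Y) e'); split.
  - apply cart_fac_over.
  - apply cart_fac_comm.
Qed.

Lemma lift_factor_vert (I J : B) (u : J ~> I) (Y : fibre_ob p I)
  (Z : fibre_ob p J) (g : Z ~> Y) (e : u = @pmap _ _ p _ _ Z Y g) :
  {k : fibre_hom Z (reindex cl u Y) | lift cl u Y ∘ k = g}.
Proof.
  destruct (lift_factor (w := idm J) (eq_trans (comp_id_r u) e)) as [k [H1 H2]].
  now exists (Build_fibre_hom H1).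
Qed.

Lemma canon_comp (I K K' K'' : B) (u'' : K'' ~> I) (u' : K' ~> I) (u : K ~> I)
  (t' : K'' ~> K') (t : K' ~> K) (e' : u' ∘ t' = u'') (e : u ∘ t = u')
  (e'' : u ∘ (t ∘ t') = u'') (X : fibre_ob p I) :
  canon cl e'' X = canon cl e X ∘ canon cl e' X.
Proof.
  apply (lift_inj (Z := reindex cl u'' X)).
  - now rewrite (pmap_comp (Y := reindex cl u' X)), !canon_over.
  - now rewrite comp_assoc, !lift_canon.
Qed.

Lemma canon_irr (I K K' : B) (u' : K' ~> I) (u : K ~> I) (t t' : K' ~> K)
  (e : u ∘ t = u') (e' : u ∘ t' = u') (X : fibre_ob p I) :
  t = t' -> canon cl e X = canon cl e' X.
Proof. intros <-; now rewrite (proof_irrelevance _ e e'). Qed.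

Lemma canon_sq_comp (m : vmap p) (K K' K'' : B) (u'' : K'' ~> vbase m)
  (u' : K' ~> vbase m) (u : K ~> vbase m)
  (t' : K'' ~> K') (t : K' ~> K) (e' : u' ∘ t' = u'') (e : u ∘ t = u')
  (e'' : u ∘ (t ∘ t') = u'') :
  canon_sq cl (m := m) e'' =
  @comp (vert p) _ _ _ (canon_sq cl (m := m) e) (canon_sq cl (m := m) e').
Proof. apply vsq_ext; apply canon_comp. Qed.

(** * Pushouts of vertical maps *)

(** The fibre pushout of the opcartesian transports is already a pushout in the
    total category, because reindexing turns a cocone over an arbitrary base map
    into a vertical one. *)
Record vertical_pushout (H J : B) (A C : fibre_ob p H) (X : fibre_ob p J)
    (v : fibre_hom A C) (a : A ~> X) := {
  vp_ob : fibre_ob p J;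
  vp_in : fibre_hom X vp_ob;
  vp_glue : C ~> vp_ob;
  vp_comm : vp_glue ∘ v = vp_in ∘ a;
  vp_univ : forall (Z : E) (x : X ~> Z) (c : C ~> Z), c ∘ v = x ∘ a ->
    exists! k : vp_ob ~> Z, k ∘ vp_in = x /\ k ∘ vp_glue = c
}.

Lemma vertical_pushout_exists (opcl : cloven_opfibration p)
  (po : forall I : B, pushouts (fibre p I)) (H J : B) (A C : fibre_ob p H)
  (X : fibre_ob p J) (v : fibre_hom A C) (a : A ~> X) : vertical_pushout v a.
Proof.
  pose (tau := @pmap _ _ p _ _ A X a).
  destruct (opcartesian_lift opcl tau A) as [A' [lA [HA cA]]].
  destruct (opcartesian_lift opcl tau C) as [C' [lC [HC cC]]].
  (* Transport [v] and [a] along the opcartesian maps to a span in the fibre over [J]. *)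
  assert (Hv : exists! k : A' ~> C',
    @pmap _ _ p _ _ A' C' k = idm J /\ k ∘ lA = lC ∘ v).
  { apply cA. now rewrite HA, pmap_vert_r, HC, comp_id_l. }
  assert (Ha : exists! k : A' ~> X, @pmap _ _ p _ _ A' X k = idm J /\ k ∘ lA = a).
  { apply cA. now rewrite HA, comp_id_l. }
  apply the_unique in Hv; destruct Hv as [v' [Hv1 Hv2]].
  apply the_unique in Ha; destruct Ha as [a' [Ha1 Ha2]].
  destruct (po J _ _ _ (Build_fibre_hom Hv1 : @Hom (op (fibre p J)) C' A')
    (Build_fibre_hom Ha1 : @Hom (op (fibre p J)) X A')) as [Q g i Hq Uq].
  simpl in g, i, Q, Hq.
  apply (f_equal (fun h => fib_map h)) in Hq; simpl in Hq.
  unshelve refine (@Build_vertical_pushout _ _ _ _ _ _ _ Q i (g ∘ lC) _ _).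
  - now rewrite <- comp_assoc, <- Hv2, comp_assoc, Hq, <- comp_assoc, Ha2.
  - intros Z0 x c Hxc.
    assert (HZ : exists (I : B) (Z : fibre_ob p I), Z0 = fib_ob Z)
      by now exists (p Z0), (@Build_fibre_ob B E p (p Z0) Z0 eq_refl).
    destruct HZ as [I [Z ->]].
    (* The base map of [x] fixes that of [c], because [v] is vertical; reindexing [Z] along [s] then
       gives a cocone in the fibre over [J]. *)
    pose (s := @pmap _ _ p _ _ X Z x).
    assert (Hs : @pmap _ _ p _ _ C Z c = s ∘ tau).
    { rewrite <- (pmap_vert_r (Y := C) c v), Hxc. apply (pmap_comp (Y := X)). }
    destruct (cC _ Z c s) as [c1 [[Hc1 Hc2] _]]; [now rewrite HC|].
    destruct (lift_factor_vert (u := s) (Z := X) (g := x) eq_refl) as [x' Hx'].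
    destruct (lift_factor_vert (u := s) (Z := C') (g := c1) (eq_sym Hc1)) as [c' Hc'].
    destruct (Uq (reindex cl s Z) c' x') as [h [[Hh1 Hh2] Uh]].
    { apply fibre_hom_ext; simpl.
      (* The square is tested after the cartesian lift of [Z] and before the opcartesian map
         [lA]. *)
      apply (lift_inj (Z := A')).
      - now rewrite !pmap_vert_l, Hv1, Ha1.
      - apply (opcartesian_epi (Y := A') (Z := Z) cA).
        + rewrite !(pmap_comp (Y := reindex cl s Z)).
          now rewrite !pmap_vert_l, Hv1, Ha1.
        + reassoc. rewrite Hv2, Ha2.
          now rewrite (comp_eq_r Hc'), (comp_eq_r Hx'), (comp_eq_r Hc2). }
    apply (f_equal (fun h => fib_map h)) in Hh1, Hh2; simpl in Hh1, Hh2.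
    exists (lift cl s Z ∘ h); split; [split|].
    + now rewrite <- comp_assoc, Hh2.
    + rewrite <- comp_assoc, (comp_eq_r Hh1), (comp_eq_r Hc'); exact Hc2.
    + intros k [Hk1 Hk2].
      (* Since [i] is vertical, [k] lies over [s] and factors vertically through the lift of [Z]. *)
      assert (Hk : @pmap _ _ p _ _ Q Z k = s).
      { rewrite <- (pmap_vert_r (Y := Q) k i), Hk1; reflexivity. }
      destruct (lift_factor_vert (u := s) (Z := Q) (g := k) (eq_sym Hk)) as [k' Hk'].
      rewrite <- Hk'; f_equal; f_equal.
      apply Uh; split; apply fibre_hom_ext; simpl.
      * apply (lift_inj (Z := C')).
        -- now rewrite pmap_vert_l, !fib_vert.
        -- rewrite Hc', (comp_eq_r Hk').
           apply (opcartesian_epi (Y := C') (Z := Z) cC).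
           ++ now rewrite pmap_vert_r, Hk, Hc1.
           ++ rewrite <- comp_assoc; congruence.
      * apply (lift_inj (Z := X)).
        -- now rewrite pmap_vert_l, !fib_vert.
        -- now rewrite (comp_eq_r Hk'), Hk1.
Qed.


(** * Universal lifting problems *)

(** No map from [hc_ob] to [J] is recorded, since it is the base map of [hc_map]. *)
Record hom_classifier (I J : B) (A : fibre_ob p I) (D : fibre_ob p J) := {
  hc_ob : B;
  hc_src : hc_ob ~> I;
  hc_map : reindex cl hc_src A ~> D;
  hc_univ : forall (K : B) (s : K ~> I) (g : reindex cl s A ~> D),
    exists! t : K ~> hc_ob, exists e : hc_src ∘ t = s,
      g = hc_map ∘ canon cl e A
}.

(** A map over [K ~> I] and [K ~> J] is a vertical map between reindexings along
    [K ~> I * J], so local smallness over the product classifies it. *)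
Lemma hom_classifier_exists (lim : finite_limits B) (ls : locally_small cl)
  (I J : B) (A : fibre_ob p I) (D : fibre_ob p J) : hom_classifier A D.
Proof.
  destruct lim as [[one to_one one_uniq] pbs].
  (* The product of [I] and [J], as a pullback over the terminal object. *)
  destruct (pbs I J one (to_one I) (to_one J)) as [P q1 q2 _ UP].
  assert (UP' : forall K (s : K ~> I) (t : K ~> J),
             exists! u : K ~> P, q1 ∘ u = s /\ q2 ∘ u = t)
    by (intros; apply UP, one_uniq).
  clear UP.
  destruct (ls P (reindex cl q1 A) (reindex cl q2 D)) as [u0 iso bij nat].
  pose (gam := iso u0 (idm u0)).
  assert (yoneda : forall (u : slice P) (k : u ~> u0),
             iso u k = hom_restrict k gam).
  { intros u k; unfold gam; rewrite <- nat.
    now rewrite comp_id_l. }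
  assert (restr : forall K (u : K ~> P) (t : K ~> sl_dom u0)
     (Ht : sl_arr u0 ∘ t = u),
     lift cl u (reindex cl q2 D) ∘
       hom_restrict (@Build_slice_hom B P (Build_slice_ob u) u0 t Ht) gam =
     lift cl (sl_arr u0) (reindex cl q2 D) ∘
       (gam ∘ canon cl Ht (reindex cl q1 A)))
    by (intros; apply cart_fac_comm).
  (* [q] and [r] are composites of two lifts, cartesian over [q1 ∘ u] and [q2 ∘ u]. *)
  pose (q := fun K (u : K ~> P) =>
               lift cl q1 A ∘ lift cl u (reindex cl q1 A)).
  pose (r := fun K (u : K ~> P) =>
               lift cl q2 D ∘ lift cl u (reindex cl q2 D)).
  assert (q_over : forall K (u : K ~> P),
     @pmap _ _ p _ _ (reindex cl u (reindex cl q1 A)) A (q K u) = q1 ∘ u).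
  { intros; unfold q; now rewrite (pmap_comp (Y := reindex cl q1 A)), !lift_over. }
  assert (r_over : forall K (u : K ~> P),
     @pmap _ _ p _ _ (reindex cl u (reindex cl q2 D)) D (r K u) = q2 ∘ u).
  { intros; unfold r; now rewrite (pmap_comp (Y := reindex cl q2 D)), !lift_over. }
  assert (q_inj : forall K K' (u : K ~> P) (Z : fibre_ob p K')
     (a b : Z ~> reindex cl u (reindex cl q1 A)),
     @pmap _ _ p _ _ Z (reindex cl u (reindex cl q1 A)) a =
     @pmap _ _ p _ _ Z (reindex cl u (reindex cl q1 A)) b ->
     q K u ∘ a = q K u ∘ b -> a = b).
  { unfold q; intros K K' u Z a b H1 H2.
    rewrite <- !comp_assoc in H2.
    apply (lift_inj (Z := Z)); [exact H1|].
    apply (lift_inj (Z := Z)); [|exact H2].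
    now rewrite !(pmap_comp (Y := reindex cl u (reindex cl q1 A))), H1. }
  (* The cleavage need not be split, so reindexing along a composite has to be compared with
     iterated reindexing. *)
  assert (theta : forall K (u : K ~> P),
     {h : fibre_hom (reindex cl (q1 ∘ u) A) (reindex cl u (reindex cl q1 A)) |
        q K u ∘ h = lift cl (q1 ∘ u) A}).
  { intros K u.
    destruct (lift_factor (u := q1) (w := u) (g := lift cl (q1 ∘ u) A))
      as [h1 [H1 H1']]; [now rewrite lift_over|].
    destruct (lift_factor_vert (eq_sym H1)) as [h H2].
    exists h; unfold q; now rewrite <- comp_assoc, H2. }
  destruct (theta _ (sl_arr u0)) as [th0 Hth0].
  refine (@Build_hom_classifier I J A D (sl_dom u0) (q1 ∘ sl_arr u0)
            (r _ (sl_arr u0) ∘ (gam ∘ th0)) _).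
  intros K s g.
  (* The source [s] and the base map of [g] together give [u]; [g2] below is [g] read as a vertical
     map between reindexings along [u]. *)
  destruct (UP' K s (@pmap _ _ p _ _ (reindex cl s A) D g))
    as [u [[Hu1 Hu2] Uu]].
  subst s.
  destruct (theta K u) as [th Hth].
  destruct (lift_factor_vert (u := q1 ∘ u) (g := q K u) (eq_sym (q_over K u)))
    as [th' Hth'].
  assert (th_inv : th' ∘ th = idm _).
  { apply (lift_inj (Z := reindex cl (q1 ∘ u) A)).
    - now rewrite pmap_vert_l, fib_vert, pmap_id.
    - now rewrite comp_assoc, Hth', Hth, comp_id_r. }
  destruct (lift_factor (u := q2) (w := u) (Z := reindex cl u (reindex cl q1 A))
    (g := g ∘ th')) as [g1 [Hg1 Hg1']]; [now rewrite pmap_vert_r|].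
  destruct (lift_factor_vert (eq_sym Hg1)) as [g2 Hg2].
  assert (Hg : r K u ∘ g2 = g ∘ th')
    by (unfold r; now rewrite <- comp_assoc, Hg2).
  pose (U := Build_slice_ob u).
  (* The comparison maps are natural in the indexing object. *)
  assert (thK : forall (t : K ~> sl_dom u0) (Ht : sl_arr u0 ∘ t = u)
      (e : (q1 ∘ sl_arr u0) ∘ t = q1 ∘ u),
      canon cl Ht (reindex cl q1 A) ∘ th = th0 ∘ canon cl e A).
  { intros t Ht e.
    apply (q_inj _ _ _ (reindex cl (q1 ∘ u) A)).
    - now rewrite pmap_vert_r, pmap_vert_l, !canon_over.
    - rewrite (comp_eq_r Hth0), lift_canon, <- Hth.
      unfold q; reassoc; now rewrite (comp_eq_r (lift_canon cl Ht _)). }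
  destruct (proj2 (bij U) g2) as [[t Ht] Hk]; simpl in t, Ht.
  exists t; split.
  - assert (e : (q1 ∘ sl_arr u0) ∘ t = q1 ∘ u) by now rewrite <- comp_assoc, Ht.
    exists e.
    reassoc.
    rewrite <- (thK t Ht e).
    rewrite <- (comp_id_r g), <- th_inv, comp_assoc, <- Hg, <- Hk, yoneda.
    unfold r; reassoc. f_equal.
    now rewrite (comp_eq_r (restr _ _ t Ht)); reassoc.
  - intros t' [e Ht'].
    (* The base map of [g] determines [sl_arr u0 ∘ t'], so [t'] is a map in the slice and
       injectivity of the representation applies. *)
    assert (Htu : sl_arr u0 ∘ t' = u).
    { symmetry; apply Uu; split; [now rewrite comp_assoc|].
      rewrite Ht', <- comp_assoc.
      rewrite (pmap_comp (Y := reindex cl (sl_arr u0) (reindex cl q2 D))),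
        r_over.
      reassoc; now rewrite !pmap_vert_l, canon_over. }
    enough (Hkk : @Build_slice_hom B P U u0 t Ht =
                  @Build_slice_hom B P U u0 t' Htu)
      by exact (f_equal (fun k => sl_map k) Hkk).
    apply (proj1 (bij U)); rewrite Hk, yoneda.
    apply fibre_hom_ext.
    apply (lift_inj (Z := reindex cl u (reindex cl q1 A))).
    { now rewrite !fib_vert. }
    apply (lift_inj (Z := reindex cl u (reindex cl q1 A))).
    { now rewrite !pmap_vert_r. }
    transitivity (g ∘ th'); [now rewrite <- Hg1', <- Hg2|].
    refine (eq_trans _ (f_equal (fun h => lift cl q2 D ∘ h)
      (eq_sym (restr _ u t' Htu)))).
    assert (Hth2 : th ∘ th' = idm _).
    { apply (q_inj _ _ _ (reindex cl u (reindex cl q1 A))).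
      - now rewrite pmap_vert_l, fib_vert, pmap_id.
      - now rewrite (comp_eq_r Hth), Hth', comp_id_r. }
    rewrite Ht'. reassoc.
    pose proof (comp_eq_r (thK t' Htu e) th') as Hk'.
    rewrite Hth2, comp_id_r in Hk'.
    rewrite Hk'; unfold r; now reassoc.
Qed.

Lemma canon_reindex_hom (I K K' : B) (X Y : fibre_ob p I) (v : fibre_hom X Y)
  (u' : K' ~> I) (u : K ~> I) (t : K' ~> K) (e : u ∘ t = u') :
  canon cl e Y ∘ reindex_hom cl u' v = reindex_hom cl u v ∘ canon cl e X.
Proof. exact (sq_comm (canon_sq cl (m := Build_vmap v) e)). Qed.

(** The condition on targets is automatic, because the target of a family is the base map of its
    square. *)
Lemma factors_through_intro (m f : vmap p) (P' P : lifting_family cl m f)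
  (t : lf_index P' ~> lf_index P) (e : lf_src P ∘ t = lf_src P') :
  lf_sq P' = @comp (vert p) _ _ _ (lf_sq P) (canon_sq cl e) ->
  factors_through t.
Proof.
  intros H; split; [|now exists e].
  rewrite <- (lf_over P), <- (lf_over P'), H; unfold sq_base; simpl.
  now rewrite (pmap_comp (Y := reindex cl (lf_src P) (vdom m))), canon_over.
Qed.

Definition family_of_square (m f : vmap p) (K : B) (u : K ~> vbase m)
    (q : vsq (reindex_vmap cl u) f) : lifting_family cl m f :=
  @Build_lifting_family _ _ _ cl m f K u (sq_base q) q eq_refl.

(** [H1], [H2] and [H3] classify the upper sides, the lower sides and the composites from [vdom m]
    to [vcod f]; the pullback of [a] and [b] classifies pairs of sides whose composites agree. *)
Lemma universal_lifting_problem_exists (lim : finite_limits B)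
  (ls : locally_small cl) (m f : vmap p) : universal_lifting_problem cl m f.
Proof.
  destruct (hom_classifier_exists lim ls (vdom m) (vdom f)) as [H1 s1 g1 U1].
  destruct (hom_classifier_exists lim ls (vcod m) (vcod f)) as [H2 s2 g2 U2].
  destruct (hom_classifier_exists lim ls (vdom m) (vcod f)) as [H3 s3 g3 U3].
  destruct (the_unique (U3 _ s1 (varr f ∘ g1))) as [a Ha].
  destruct (the_unique (U3 _ s2 (g2 ∘ reindex_hom cl s2 (varr m)))) as [b Hb].
  destruct (snd lim _ _ _ a b) as [Q r1 r2 Hr UQ].
  (* Both source maps are [s3] after the common map into [H3]. *)
  assert (e2 : s2 ∘ r2 = s1 ∘ r1).
  { destruct Ha as [<- _], Hb as [<- _]. now rewrite <- !comp_assoc, Hr. }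
  unshelve refine (let q := @Build_vsq _ _ p (reindex_vmap cl (m := m) (s1 ∘ r1)) f
     (g1 ∘ canon cl (eq_refl : s1 ∘ r1 = _) (vdom m))
     (g2 ∘ canon cl e2 (vcod m)) _ in
     @Build_universal_lifting_problem _ _ _ cl m f (family_of_square q) _).
  - destruct Ha as [ea Ha], Hb as [eb Hb]; simpl_sq.
    rewrite <- comp_assoc, canon_reindex_hom, !comp_assoc, Hb, Ha, <- !comp_assoc.
    f_equal.
    assert (e : s3 ∘ (a ∘ r1) = s1 ∘ r1) by now rewrite comp_assoc, ea.
    assert (e' : s3 ∘ (b ∘ r2) = s1 ∘ r1) by now rewrite <- Hr.
    rewrite <- (canon_comp _ _ e), <- (canon_comp _ _ e').
    now apply canon_irr.
  - intros [K u v [x y Hxy] Hv]; cbn [varr vdom vcod reindex_vmap] in x, y, Hxy;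
      simpl in u, v.
    destruct (U1 K u x) as [t1 [[e1 Ht1] Ut1]].
    destruct (U2 K u y) as [t2 [[e2' Ht2] Ut2]].
    (* Commutativity of the given square means that both maps into [H3] classify the same
       composite. *)
    assert (Hab : a ∘ t1 = b ∘ t2).
    { destruct (U3 K u (varr f ∘ x)) as [t3 [_ Ut3]].
      destruct Ha as [ea Ha], Hb as [eb Hb].
      rewrite <- (Ut3 (a ∘ t1)), <- (Ut3 (b ∘ t2)); [reflexivity| |].
      - assert (e : s3 ∘ (b ∘ t2) = u) by now rewrite comp_assoc, eb.
        exists e.
        rewrite (canon_comp e2' eb e), comp_assoc, <- Hb, <- Hxy, Ht2.
        now rewrite <- !comp_assoc, canon_reindex_hom.
      - assert (e : s3 ∘ (a ∘ t1) = u) by now rewrite comp_assoc, ea.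
        exists e.
        now rewrite (canon_comp e1 ea e), comp_assoc, <- Ha, Ht1, <- comp_assoc. }
    destruct (UQ K t1 t2 Hab) as [t [[Hr1 Hr2] Ut]].
    exists t; split.
    + assert (e : (s1 ∘ r1) ∘ t = u) by now rewrite <- comp_assoc, Hr1.
      apply (@factors_through_intro _ _ (Build_lifting_family Hv)
               (family_of_square q) t e).
      apply vsq_ext; simpl; rewrite <- comp_assoc.
      * assert (e' : s1 ∘ (r1 ∘ t) = u) by now rewrite comp_assoc.
        rewrite <- (canon_comp e eq_refl e'), Ht1.
        f_equal; now apply canon_irr.
      * assert (e' : s2 ∘ (r2 ∘ t) = u) by now rewrite comp_assoc, e2.
        rewrite <- (canon_comp e e2 e'), Ht2.
        f_equal; now apply canon_irr.
    + intros t' [_ [e Ht']]; simpl in e.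
      apply Ut; split; symmetry.
      * apply Ut1.
        assert (e' : s1 ∘ (r1 ∘ t') = u) by now rewrite comp_assoc.
        exists e'; rewrite (canon_comp e eq_refl e'), comp_assoc.
        exact (f_equal (fun s => sq_dom s) Ht').
      * apply Ut2.
        assert (e' : s2 ∘ (r2 ∘ t') = u) by now rewrite comp_assoc, e2.
        exists e'; rewrite (canon_comp e e2 e'), comp_assoc.
        exact (f_equal (fun s => sq_cod s) Ht').
Qed.

(** * Natural fillings *)

Variable m : vmap p.

(** The data out of which maps [K f ~> Z] are built; quantifying over all families
    rather than the universal one makes functoriality and the comonad laws
    independent of any comparison between indices. *)
Record filling (f : vmap p) (Z : E) := {
  fl_left : vdom f ~> Z;
  fl_fill : forall (K : B) (u : K ~> vbase m),
    vsq (reindex_vmap cl u) f -> (reindex cl u (vcod m) ~> Z);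
  fl_upper : forall (K : B) (u : K ~> vbase m) (q : vsq (reindex_vmap cl u) f),
    fl_fill q ∘ reindex_hom cl u (varr m) = fl_left ∘ sq_dom q;
  fl_canon : forall (K' K : B) (u' : K' ~> vbase m) (u : K ~> vbase m)
    (t : K' ~> K) (e : u ∘ t = u') (q : vsq (reindex_vmap cl u) f),
    fl_fill (@comp (vert p) _ _ _ q (canon_sq cl e)) =
    fl_fill q ∘ canon cl e (vcod m)
}.

Definition precomp_filling (f g : vmap p) (s : vsq f g) (Z : E)
    (c : filling g Z) : filling f Z.
Proof.
  refine (@Build_filling f Z (fl_left c ∘ sq_dom s)
    (fun K u q => fl_fill c (@comp (vert p) _ _ _ s q)) _ _).
  - intros; rewrite fl_upper; apply comp_assoc.
  - intros; rewrite (@comp_assoc (vert p)); apply fl_canon.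
Defined.

(** The map it induces out of the free filling is the right factor of [f]. *)
Definition cod_filling (f : vmap p) : filling f (vcod f).
Proof.
  refine (@Build_filling f (vcod f) (varr f) (fun K u q => sq_cod q) _ _).
  - intros; apply (sq_comm q).
  - reflexivity.
Defined.

Record free_filling (f : vmap p) := {
  free_ob : fibre_ob p (vbase f);
  free_unit :> filling f free_ob;
  free_vert : @pmap _ _ p _ _ (vdom f) free_ob (fl_left free_unit) = idm _;
  free_univ : forall (Z : E) (c : filling f Z), exists! k : free_ob ~> Z,
    k ∘ fl_left free_unit = fl_left c /\
    forall K (u : K ~> vbase m) (q : vsq (reindex_vmap cl u) f),
      k ∘ fl_fill free_unit q = fl_fill c q
}.

Definition desc (f : vmap p) (F : free_filling f) (Z : E) (c : filling f Z) :
    free_ob F ~> Z := proj1_sig (the_unique (free_univ F c)).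

Lemma desc_left (f : vmap p) (F : free_filling f) (Z : E) (c : filling f Z) :
  desc F c ∘ fl_left F = fl_left c.
Proof. apply (proj2_sig (the_unique (free_univ F c))). Qed.

Lemma desc_fill (f : vmap p) (F : free_filling f) (Z : E) (c : filling f Z)
  (K : B) (u : K ~> vbase m) (q : vsq (reindex_vmap cl u) f) :
  desc F c ∘ fl_fill F q = fl_fill c q.
Proof. apply (proj2_sig (the_unique (free_univ F c))). Qed.

Definition postcomp_filling (f : vmap p) (Z Z' : E) (k : Z ~> Z')
    (c : filling f Z) : filling f Z'.
Proof.
  refine (@Build_filling f Z' (k ∘ fl_left c) (fun K u q => k ∘ fl_fill c q) _ _).
  - intros; now rewrite <- !comp_assoc, fl_upper.
  - intros; now rewrite <- !comp_assoc, fl_canon.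
Defined.

Lemma free_filling_ext (f : vmap p) (F : free_filling f) (Z : E)
  (a b : free_ob F ~> Z) :
  a ∘ fl_left F = b ∘ fl_left F ->
  (forall K (u : K ~> vbase m) (q : vsq (reindex_vmap cl u) f),
      a ∘ fl_fill F q = b ∘ fl_fill F q) -> a = b.
Proof.
  intros H1 H2.
  destruct (free_univ F (postcomp_filling a F)) as [k [_ Uk]].
  transitivity k; [symmetry|]; apply Uk; split; simpl; auto.
Qed.

(** * Fillings determined by their value on a universal lifting problem *)

Section FromUniversal.

Variables (f : vmap p) (P : universal_lifting_problem cl m f).

Lemma family_of_square_factors (K : B) (u : K ~> vbase m)
  (q : vsq (reindex_vmap cl u) f) :
  {t : K ~> lf_index P | exists e : lf_src P ∘ t = u,
      q = @comp (vert p) _ _ _ (lf_sq P) (canon_sq cl e)}.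
Proof.
  destruct (the_unique (ulp_universal P (family_of_square q))) as [t [_ Ht]].
  now exists t.
Qed.

Lemma universal_ext (K : B) (u : K ~> vbase m) (t t' : K ~> lf_index P)
  (e : lf_src P ∘ t = u) (e' : lf_src P ∘ t' = u) :
  @comp (vert p) _ _ _ (lf_sq P) (canon_sq cl e) =
  @comp (vert p) _ _ _ (lf_sq P) (canon_sq cl e') -> t = t'.
Proof.
  intros H.
  pose (P' := family_of_square (@comp (vert p) _ _ _ (lf_sq P) (canon_sq cl e))).
  destruct (ulp_universal P P') as [t0 [_ U]].
  transitivity t0; [symmetry|]; apply U.
  - now apply (@factors_through_intro _ _ P' P t e).
  - now apply (@factors_through_intro _ _ P' P t' e').
Qed.

(** Every problem is the restriction of the universal one along its classifying map, so a single [g]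
    fills them all; uniqueness of the classifying map gives naturality. *)
Definition filling_of_solution (Z : E) (x : vdom f ~> Z)
    (g : reindex cl (lf_src P) (vcod m) ~> Z)
    (H : g ∘ reindex_hom cl (lf_src P) (varr m) = x ∘ sq_dom (lf_sq P)) :
    filling f Z.
Proof.
  refine (@Build_filling f Z x (fun K u q =>
    g ∘ canon cl (proj1_sig (constructive_indefinite_description _
                     (proj2_sig (family_of_square_factors q)))) (vcod m)) _ _).
  - intros K u q.
    destruct (constructive_indefinite_description _ _) as [e He];
      cbn [proj1_sig proj2_sig].
    (* The type of [e] mentions the chosen classifying map, so [e] is generalised before that map is
       destructed. *)
    revert e He; destruct (family_of_square_factors q) as [t Ht];
      cbn [proj1_sig proj2_sig].
    intros e ->; simpl_sq.
    now rewrite <- comp_assoc, canon_reindex_hom, !comp_assoc, H.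
  - intros K' K u' u t e q.
    destruct (constructive_indefinite_description _ _) as [e1 He1];
      cbn [proj1_sig proj2_sig].
    destruct (constructive_indefinite_description _ _) as [e2 He2];
      cbn [proj1_sig proj2_sig].
    revert e1 He1 e2 He2.
    destruct (family_of_square_factors _) as [t1 Ht1];
      cbn [proj1_sig proj2_sig].
    destruct (family_of_square_factors _) as [t2 Ht2];
      cbn [proj1_sig proj2_sig].
    intros e1 He1 e2 He2.
    rewrite <- comp_assoc; f_equal.
    (* [t1] and [t2 ∘ t] both classify the restriction of [q] along [t]. *)
    assert (e3 : lf_src P ∘ (t2 ∘ t) = u') by now rewrite comp_assoc, e2.
    rewrite <- (canon_comp e e2 e3); apply canon_irr.
    apply (@universal_ext _ _ _ _ e1 e3).
    rewrite <- He1, (canon_sq_comp e e2 e3), He2; symmetry; apply comp_assoc.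
Defined.

(** The universal square is classified by the identity, and the canonical map over it is again an
    identity. *)
Lemma filling_of_solution_universal (Z : E) (x : vdom f ~> Z)
  (g : reindex cl (lf_src P) (vcod m) ~> Z)
  (H : g ∘ reindex_hom cl (lf_src P) (varr m) = x ∘ sq_dom (lf_sq P)) :
  fl_fill (filling_of_solution H) (lf_sq P) = g.
Proof.
  cbn [fl_fill filling_of_solution].
  destruct (constructive_indefinite_description _ _) as [e He];
      cbn [proj1_sig proj2_sig].
  revert e He.
  destruct (family_of_square_factors _) as [t Ht]; cbn [proj1_sig proj2_sig];
    intros e He.
  assert (e1 : lf_src P ∘ idm _ = lf_src P) by apply comp_id_r.
  assert (H1 : forall X, canon cl e1 X = idm _).
  { intros X; apply (lift_inj (Z := reindex cl (lf_src P) X)).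
    - now rewrite canon_over, pmap_id.
    - now rewrite lift_canon, comp_id_r. }
  rewrite (canon_irr e e1), H1, comp_id_r; [reflexivity|].
  apply (universal_ext (e := e) (e' := e1)).
  rewrite <- He; apply vsq_ext; simpl; now rewrite H1, comp_id_r.
Qed.

(** [t] and [e] come before [c], so one factorisation serves every filling of [f]. *)
Lemma fill_factor (K : B) (u : K ~> vbase m)
  (q : vsq (reindex_vmap cl u) f) : exists (t : K ~> lf_index P)
    (e : lf_src P ∘ t = u),
    forall (Z : E) (c : filling f Z),
      fl_fill c q = fl_fill c (lf_sq P) ∘ canon cl e (vcod m).
Proof.
  destruct (family_of_square_factors q) as [t [e ->]].
  exists t, e; intros; apply fl_canon.
Qed.

Lemma free_filling_exists (opcl : cloven_opfibration p)
  (po : forall I : B, pushouts (fibre p I)) : free_filling f.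
Proof.
  destruct (vertical_pushout_exists opcl po
    (reindex_hom cl (lf_src P) (varr m)) (sq_dom (lf_sq P) : _ ~> vdom f))
    as [Q i g Hg U].
  unshelve refine (@Build_free_filling f Q (filling_of_solution Hg) _ _).
  - apply fib_vert.
  - intros Z c.
    (* At the universal square a filling gives a cocone on the pushout span. *)
    destruct (U Z (fl_left c) (fl_fill c (lf_sq P)) (fl_upper c (lf_sq P)))
      as [k [[Hk1 Hk2] Uk]].
    exists k; split; [split; [exact Hk1|]|].
    + intros K u q.
      destruct (fill_factor q) as [t [e He]].
      rewrite !He, filling_of_solution_universal, comp_assoc; congruence.
    + intros k' [Hk1' Hk2']; apply Uk; split; [exact Hk1'|].
      now rewrite <- Hk2', filling_of_solution_universal.
Qed.

End FromUniversal.

(** * The lawfs of free fillings *)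

Variable Fr : forall f : vmap p, free_filling f.

Lemma desc_left_assoc (f : vmap p) (Z Z' : E) (c : filling f Z)
  (k : Z' ~> vdom f) :
  desc (Fr f) c ∘ (fl_left (Fr f) ∘ k) = fl_left c ∘ k.
Proof. apply comp_eq_r, desc_left. Qed.

Lemma pmap_desc (f : vmap p) (J : B) (Z : fibre_ob p J) (c : filling f Z) :
  @pmap _ _ p _ _ (free_ob (Fr f)) Z (desc (Fr f) c) =
  @pmap _ _ p _ _ (vdom f) Z (fl_left c).
Proof.
  now rewrite <- (desc_left (Fr f) c), (pmap_comp (Y := free_ob (Fr f))),
    free_vert, comp_id_r.
Qed.

Ltac free_ext :=
  apply free_filling_ext; [|intros ? ? ?]; reassoc;
  repeat progress (rewrite ?desc_left_assoc, ?desc_left, ?desc_fill;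
                   cbn [fl_left fl_fill precomp_filling cod_filling]).

Definition filling_factorisation : functorial_factorisation p.
Proof.
  unshelve refine (@Build_functorial_factorisation _ _ p
    (fun f => free_ob (Fr f))
    (fun f => @Build_fibre_hom _ _ p _ (vdom f) (free_ob (Fr f))
                (fl_left (Fr f)) (free_vert (Fr f)))
    (fun f => @Build_fibre_hom _ _ p _ (free_ob (Fr f)) (vcod f)
                (desc (Fr f) (cod_filling f)) _)
    _ (fun f g s => desc (Fr f) (precomp_filling s (Fr g))) _ _ _ _ _).
  - rewrite pmap_desc; apply fib_vert.
  - intros f; apply desc_left.
  - intros f g s; apply desc_left.
  - intros f g s; cbn [fib_map]; free_ext.
    + apply sq_comm.
    + reflexivity.
  - intros f g s; rewrite pmap_desc; cbn [fl_left precomp_filling].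
    now rewrite (pmap_comp (Y := vdom g)), free_vert, comp_id_l.
  - intros f; free_ext; rewrite ?comp_id_l; [apply comp_id_r|reflexivity].
  - intros f g h t s; free_ext.
    + exact (comp_assoc _ (sq_dom t) (sq_dom s)).
    + now rewrite (@comp_assoc (vert p)).
Defined.

Definition fill_sq (f : vmap p) (K : B) (u : K ~> vbase m)
    (q : vsq (reindex_vmap cl u) f) :
    vsq (reindex_vmap cl u) (L_ob filling_factorisation f) :=
  @Build_vsq _ _ _ (reindex_vmap cl u) (L_ob filling_factorisation f)
    (sq_dom q) (fl_fill (Fr f) q) (fl_upper (Fr f) q).

Definition comult_filling (f : vmap p) :
    filling f (free_ob (Fr (L_ob filling_factorisation f))).
Proof.
  refine (@Build_filling f _ (fl_left (Fr (L_ob filling_factorisation f)))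
    (fun K u q => fl_fill (Fr (L_ob filling_factorisation f)) (fill_sq q)) _ _).
  - intros K u q; exact (fl_upper _ (fill_sq q)).
  - intros K' K u' u t e q; rewrite <- fl_canon; f_equal.
    apply vsq_ext; [reflexivity|exact (fl_canon (Fr f) e q)].
Defined.

(** [desc_left] and [desc_fill] at [L_ob f], with the base and domain of [L_ob f]
    reduced so that they can be used for rewriting. *)
Lemma desc_left_L (f : vmap p) (Z : E)
  (c : filling (L_ob filling_factorisation f) Z) :
  @comp E (vdom f)
    (@fib_ob _ _ p (vbase f) (free_ob (Fr (L_ob filling_factorisation f)))) _
    (desc (Fr (L_ob filling_factorisation f)) c)
    (fl_left (Fr (L_ob filling_factorisation f))) = fl_left c.
Proof. exact (desc_left (Fr (L_ob filling_factorisation f)) c). Qed.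

Lemma desc_fill_L (f : vmap p) (Z : E)
  (c : filling (L_ob filling_factorisation f) Z) (K : B) (u : K ~> vbase m)
  (q : vsq (reindex_vmap cl u) (L_ob filling_factorisation f)) :
  @comp E (reindex cl u (vcod m))
    (@fib_ob _ _ p (vbase f) (free_ob (Fr (L_ob filling_factorisation f)))) _
    (desc (Fr (L_ob filling_factorisation f)) c)
    (fl_fill (Fr (L_ob filling_factorisation f)) q) = fl_fill c q.
Proof. exact (desc_fill (Fr (L_ob filling_factorisation f)) c q). Qed.

Ltac comult_ext :=
  free_ext;
  repeat progress (cbn [fl_left fl_fill precomp_filling cod_filling
                        comult_filling];
                   rewrite ?desc_left_assoc, ?desc_left, ?desc_left_L,
                     ?desc_fill, ?desc_fill_L).

Definition filling_comult (f : vmap p) :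
    vsq (L_ob filling_factorisation f)
      (L_ob filling_factorisation (L_ob filling_factorisation f)).
Proof.
  refine (@Build_vsq _ _ p (L_ob filling_factorisation f)
    (L_ob filling_factorisation (L_ob filling_factorisation f))
    (idm (vdom f)) (desc (Fr f) (comult_filling f)) _).
  exact (eq_trans (desc_left (Fr f) (comult_filling f))
           (eq_sym (comp_id_r _))).
Defined.

(** Codomain components are maps out of a free filling, compared on its left part and on each
    filler. *)
Lemma filling_comonad :
  @is_comonad (vert p) (L_functor filling_factorisation)
    (L_counit filling_factorisation) filling_comult.
Proof.
  split.
  - intros f g s; apply vsq_ext; simpl_sq.
    + simpl; now rewrite comp_id_l, comp_id_r.
    + symmetry; apply (ff_map_right filling_factorisation s).
  - intros f g s; apply vsq_ext; simpl.
    + now rewrite comp_id_l, comp_id_r.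
    + comult_ext; [reflexivity|].
      (* [fill_sq] commutes with composition by [s]. *)
      f_equal; apply vsq_ext; [reflexivity|].
      symmetry; exact (desc_fill (Fr f) (precomp_filling s (Fr g)) q).
  - intros f; apply vsq_ext; simpl.
    + apply comp_id_l.
    (* The counit at [L_ob f] reads off the lower side of [fill_sq q], which is the filler of
       [q]. *)
    + comult_ext; rewrite comp_id_l; reflexivity.
  - intros f; apply vsq_ext; simpl.
    + apply comp_id_l.
    + comult_ext; rewrite comp_id_l.
      * apply comp_id_r.
      (* The counit sends [fill_sq q] back to [q]. *)
      * f_equal; apply vsq_ext; [apply comp_id_l|].
        exact (desc_fill (Fr f) (cod_filling f) q).
  - intros f; apply vsq_ext; simpl.
    + reflexivity.
    + comult_ext.
      * symmetry; apply comp_id_r.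
      (* Comultiplication carries [fill_sq q] to [fill_sq (fill_sq q)]. *)
      * f_equal; apply vsq_ext; [symmetry; apply comp_id_l|].
        symmetry; exact (desc_fill (Fr f) (comult_filling f) q).
Qed.

Definition filling_lawfs : lawfs p :=
  @Build_lawfs _ _ p filling_factorisation filling_comult
    (fun f => eq_refl) filling_comonad.

(** * The coalgebra structure on [m] *)

Lemma filling_coalgebra : L_coalgebra filling_lawfs m.
Proof.
  (* The cleavage need not be normal: [i] and [j] below are sections of the lifts over the identity,
     and [q] is the identity problem up to these. *)
  assert (sec : forall X : fibre_ob p (vbase m),
    {i : fibre_hom X (reindex cl (idm _) X) | lift cl (idm _) X ∘ i = idm X}).
  { intros X; apply lift_factor_vert; symmetry; apply pmap_id. }
  pose (q := @Build_vsq _ _ p (reindex_vmap cl (m := m) (idm _)) m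
    (lift cl (idm _) (vdom m)) (lift cl (idm _) (vcod m))
    (lift_reindex_hom cl (idm _) (varr m))).
  destruct (sec (vdom m)) as [i Hi], (sec (vcod m)) as [j Hj].
  assert (Hji : j ∘ lift cl (idm _) (vcod m) = idm _).
  { apply (lift_inj (Z := reindex cl (idm _) (vcod m))).
    - now rewrite pmap_vert_l, lift_over, pmap_id.
    - now rewrite (comp_eq_r Hj), comp_id_l, comp_id_r. }
  assert (Hij : j ∘ varr m = reindex_hom cl (idm _) (varr m) ∘ i).
  { apply (lift_inj (Z := vdom m)).
    - now rewrite !pmap_vert_l, !fib_vert.
    - rewrite (comp_eq_r Hj), comp_assoc, lift_reindex_hom, <- comp_assoc, Hi.
      now rewrite comp_id_l, comp_id_r. }
  unshelve refine (let c := @Build_vsq _ _ p m (L_ob filling_factorisation m)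
    (idm (vdom m)) (fl_fill (Fr m) q ∘ j) _ in
    @Build_coalgebra (vert p) (L_functor filling_factorisation) _ _ m c _ _).
  - simpl_sq; rewrite <- comp_assoc, Hij, comp_assoc, fl_upper, <- comp_assoc.
    exact (f_equal (fun h => fl_left (Fr m) ∘ h) Hi).
  - apply vsq_ext; [apply comp_id_l|]; simpl.
    rewrite comp_assoc, desc_fill; exact Hj.
  - apply vsq_ext; simpl.
    + reflexivity.
    + rewrite !comp_assoc, !desc_fill; simpl.
      (* It remains to see that [fill_sq q] is [c] composed with [q]. *)
      f_equal; f_equal.
      apply vsq_ext; simpl; [symmetry; apply comp_id_l|].
      now rewrite <- comp_assoc, Hji, comp_id_r.
Qed.

(** * Algebras as solutions of the universal lifting problem *)

Section Algebras.

Variables (f : vmap p) (P : universal_lifting_problem cl m f).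

(** Every filler is the universal one restricted along a canonical map. *)
Lemma free_filling_ext_universal (Z : E) (a b : free_ob (Fr f) ~> Z) :
  a ∘ fl_left (Fr f) = b ∘ fl_left (Fr f) ->
  a ∘ fl_fill (Fr f) (lf_sq P) = b ∘ fl_fill (Fr f) (lf_sq P) -> a = b.
Proof.
  intros H1 H2; apply free_filling_ext; [exact H1|].
  intros K u q; destruct (fill_factor P q) as [t [e He]].
  rewrite He, !comp_assoc; congruence.
Qed.

(** The unit of [R_functor] is the identity on codomains, so an algebra amounts to a retraction of
    the left factor over [vcod f]. *)
Lemma algebra_cod (a : R_algebra filling_lawfs f) :
  sq_cod (alg_map a) = idm (vcod f).
Proof.
  refine (eq_trans (eq_sym (comp_id_r _)) _).
  exact (f_equal (fun s => sq_cod s) (alg_unit a)).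
Qed.

Lemma algebra_dom (a : R_algebra filling_lawfs f) :
  @comp E _ (free_ob (Fr f)) _ (sq_dom (alg_map a)) (fl_left (Fr f)) =
  idm (vdom f).
Proof. exact (f_equal (fun s => sq_dom s) (alg_unit a)). Qed.

Lemma algebra_right (a : R_algebra filling_lawfs f) :
  @comp E (free_ob (Fr f)) _ _ (varr f) (sq_dom (alg_map a)) =
  desc (Fr f) (cod_filling f).
Proof.
  refine (eq_trans (eq_sym (sq_comm (alg_map a))) _).
  rewrite algebra_cod; apply comp_id_l.
Qed.

Definition solution_of_algebra (a : R_algebra filling_lawfs f) : solution P.
Proof.
  refine (@Build_solution _ _ p cl m f P
    (@comp E _ (free_ob (Fr f)) _ (sq_dom (alg_map a))
       (fl_fill (Fr f) (lf_sq P))) _ _).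
  - rewrite <- comp_assoc, fl_upper, comp_assoc, algebra_dom.
    apply comp_id_l.
  - rewrite comp_assoc, algebra_right; apply desc_fill.
Defined.

Lemma algebra_eq (a b : R_algebra filling_lawfs f) :
  sq_dom (alg_map a) = sq_dom (alg_map b) -> a = b.
Proof.
  intros H.
  assert (H' : alg_map a = alg_map b)
    by (apply vsq_ext; [exact H|now rewrite !algebra_cod]).
  destruct a as [a Ha], b as [b Hb]; simpl in H'; subst b.
  now rewrite (proof_irrelevance _ Ha Hb).
Qed.

Lemma solution_eq (j k : solution P) : sol_map j = sol_map k -> j = k.
Proof.
  destruct j as [j j1 j2], k as [k k1 k2]; simpl; intros <-.
  now rewrite (proof_irrelevance _ j1 k1), (proof_irrelevance _ j2 k2).
Qed.

Lemma solution_of_algebra_bijective : bijective solution_of_algebra.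
Proof.
  split.
  - intros a b H; apply algebra_eq, free_filling_ext_universal.
    + now rewrite !algebra_dom.
    + exact (f_equal (fun j => sol_map j) H).
  - intros j.
    (* The identity and [j] form a filling of [f] in [vdom f] whose induced map is the algebra; the
       lower triangle of [j] puts it over [vcod f]. *)
    pose (c := filling_of_solution (Z := vdom f) (x := idm (vdom f))
       (eq_trans (sol_upper j) (eq_sym (comp_id_l _)))).
    pose proof (desc_left (Fr f) c) as H1.
    pose proof (desc_fill (Fr f) c (lf_sq P)) as H2.
    unfold c in H2; rewrite filling_of_solution_universal in H2; fold c in H2.
    unshelve refine (let a := @Build_vsq _ _ p
      (R_ob filling_factorisation f) f (desc (Fr f) c) (idm (vcod f)) _ in
      ex_intro _ (@Build_pointed_algebra (vert p)
        (R_functor filling_factorisation) _ f a _) _).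
    + simpl; rewrite comp_id_l; apply free_filling_ext_universal.
      * now rewrite <- comp_assoc, H1, desc_left, comp_id_r.
      * rewrite <- comp_assoc, H2, desc_fill; symmetry; apply sol_lower.
    + apply vsq_ext; [exact H1|apply comp_id_l].
    + apply solution_eq; exact H2.
Qed.

End Algebras.

(** On codomains both sides of the algebra square equal [sq_cod s]. *)
Lemma algebra_hom_dom (f g : vmap p) (s : vsq f g)
  (a : R_algebra filling_lawfs f) (b : R_algebra filling_lawfs g) :
  R_algebra_hom s a b <->
  @comp E (free_ob (Fr f)) (vdom f) (vdom g) (sq_dom s) (sq_dom (alg_map a)) =
  @comp E (free_ob (Fr f)) (free_ob (Fr g)) (vdom g) (sq_dom (alg_map b))
    (desc (Fr f) (precomp_filling s (Fr g))).
Proof.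
  unfold R_algebra_hom, pointed_algebra_hom; split.
  - intros H; exact (f_equal (fun t => sq_dom t) H).
  - intros H; apply vsq_ext; [exact H|].
    transitivity (sq_cod s).
    + refine (eq_trans (f_equal (fun h => sq_cod s ∘ h) (algebra_cod a)) _).
      apply comp_id_r.
    + symmetry.
      refine (eq_trans (f_equal (fun h => h ∘ sq_cod s) (algebra_cod b)) _).
      apply comp_id_l.
Qed.

(** Both conditions compare [sq_dom s] after the solution for [f] with [b] applied to the filler of
    the problem [s ∘ lf_sq P]; naturality of fillers relates that filler to the one of [lf_sq Q]. *)
Lemma algebra_hom_iff_solution_hom (f g : vmap p) (s : vsq f g)
  (P : universal_lifting_problem cl m f) (Q : universal_lifting_problem cl m g)
  (a : R_algebra filling_lawfs f) (b : R_algebra filling_lawfs g) :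
  R_algebra_hom s a b <->
  solution_hom s (solution_of_algebra P a) (solution_of_algebra Q b).
Proof.
  assert (Hhom : R_algebra_hom s a b <->
    sq_dom s ∘ sol_map (solution_of_algebra P a) =
    @comp E _ (free_ob (Fr g)) _ (sq_dom (alg_map b))
      (fl_fill (Fr g) (@comp (vert p) _ _ _ s (lf_sq P)))).
  { rewrite algebra_hom_dom; cbn [sol_map solution_of_algebra].
    rewrite comp_assoc.
    change (fl_fill (Fr g) (@comp (vert p) _ _ _ s (lf_sq P)))
      with (fl_fill (precomp_filling s (Fr g)) (lf_sq P)).
    rewrite <- (desc_fill (Fr f) (precomp_filling s (Fr g))), comp_assoc.
    split; [intros H; now rewrite H|].
    (* On the left part the two sides agree by the unit laws of [a] and [b]. *)
    apply free_filling_ext_universal.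
    rewrite <- !comp_assoc, algebra_dom, desc_left; simpl.
    rewrite comp_assoc, algebra_dom, comp_id_l; apply comp_id_r. }
  rewrite Hhom; split.
  - intros H.
    destruct (the_unique (ulp_universal Q (post_family s P))) as [t Ht].
    pose proof Ht as [_ [e He]].
    exists t, e; split; [exact Ht|].
    rewrite H; cbn [sol_map solution_of_algebra]; rewrite <- comp_assoc.
    f_equal; rewrite <- fl_canon; f_equal; exact He.
  - intros [t [e [[_ [e' He]] H]]]; rewrite H.
    cbn [sol_map solution_of_algebra]; rewrite <- comp_assoc.
    f_equal; rewrite <- fl_canon; f_equal.
    rewrite (proof_irrelevance _ e e'); symmetry; exact He.
Qed.

End Fibred.

Theorem theorem4p6p3 (B E : Category) (p : Functor E B)
    (lim : finite_limits B)
    (cl : cloven_fibration p) (opcl : cloven_opfibration p)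
    (ls : locally_small cl)
    (po : forall I : B, pushouts (fibre p I))
    (m : vmap p) :
  exists W : lawfs p,
    (exists corr : forall (f : vmap p) (P : universal_lifting_problem cl m f),
        R_algebra W f -> solution P,
      (forall f P, bijective (@corr f P)) /\
      (forall f g (s : vsq f g) P Q (a : R_algebra W f) (b : R_algebra W g),
         R_algebra_hom s a b <->
         solution_hom s (corr f P a) (corr g Q b))) /\
    inhabited (L_coalgebra W m).
Proof.
  pose (Fr := fun f => free_filling_exists
    (universal_lifting_problem_exists lim ls m f) opcl po).
  exists (filling_lawfs Fr); split.
  (* [P] ranges over all universal lifting problems, not only the one from which [Fr] is built. *)
  - exists (fun f P a => solution_of_algebra P a); split.
    + intros f P; apply solution_of_algebra_bijective.
    + intros; apply algebra_hom_iff_solution_hom.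
  - exact (inhabits (filling_coalgebra Fr)).
Qed.
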